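(* Let $n\ge 2$, $p\ge0$ and $c>0$. Let $\Gamma\subsetneqq\mathbb{R}^n$ be a non-empty open symmetric cone with vertex at the origin satisfying $\Gamma+\Gamma_n\subset\Gamma$, and let $f:\Gamma\to\mathbb{R}$ be a symmetric function in $C^{0,1}_{loc}(\Gamma)$ such that for every compact $K\subset\Gamma$ there is a constant $c(K)>0$ with $\frac{\partial f}{\partial\lambda_i}\ge c(K)$ a.e. on $K$ for all $1\le i\le n$. Assume that $\lambda^*:=(1,-1,\dots,-1)\notin\overline{\Gamma}$, that $\mathbf{e_n}:=(0,\dots,0,1)\notin\partial\Gamma$ (i.e. $\mu_\Gamma^-<\infty$), that $f$ is homogeneous of degree $1$, and that $\overline{f^{-1}(1)}\cap\partial\Gamma=\emptyset$. If $p\in[0,\mu_\Gamma^-+1]$, then the problem $$\begin{cases} f(\lambda(A[v]))=e^{-pv} & \text{in } \overline{\mathbb{R}^n_+},\\ \frac{\partial v}{\partial x_n}=c\, e^{v} & \text{on } \partial\mathbb{R}^n_+\end{cases}$$ has no solution $v\in C^2(\overline{\mathbb{R}^n_+})$ depending only on the one variable $x_n$.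
   Context: $\mathbb{R}^n_+=\{x\in\mathbb{R}^n: x_n>0\}$. $\Gamma_n=\{\lambda\in\mathbb{R}^n:\lambda_i>0 \text{ for all } i\}$. A set or function is symmetric if it is invariant under permutations of the $\lambda_i$. $\mu_\Gamma^-:=\inf\{t\in\mathbb{R}: (t,-1,\dots,-1)\in\overline{\Gamma}\}\in[0,\infty]$, with $\inf\emptyset=\infty$. For a $C^2$ function $v$, $A[v]=e^{-2v}\left(-\nabla^2v+\nabla v\otimes\nabla v-\frac12|\nabla v|^2I\right)$, and $\lambda(M)$ denotes the eigenvalues of the symmetric matrix $M$ (modulo permutations). Since $f$ is defined only on $\Gamma$, writing $f(\lambda(A[v]))$ at a point means in particular that $\lambda(A[v])\in\Gamma$ there. *)

(* Defs.v *)
From HB Require Import structures.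
From mathcomp Require Import all_boot all_order all_algebra all_fingroup.
From mathcomp Require Import all_classical all_reals all_analysis.

Set Implicit Arguments.
Unset Strict Implicit.
Unset Printing Implicit Defensive.

Import Order.TTheory GRing.Theory Num.Theory.
Import numFieldNormedType.Exports.

Local Open Scope classical_set_scope.
Local Open Scope ring_scope.

(* R^n is 'rV[R]_n; the norm `|x| on it is the sup norm. Where a distinguished
   coordinate is needed the dimension has the form n.+1, the first coordinate
   is ord0 and the last one (the variable x_n of the half-space) is ord_max. *)

Definition frontier (T : topologicalType) (A : set T) : set T :=
  closure A `\` A°.

(* N has n-dimensional Lebesgue measure zero: for every e > 0 it is covered by
   countably many closed boxes of total volume at most e. *)
Definition box (R : realType) (n : nat) (a b : 'rV[R]_n) : set 'rV[R]_n :=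
  [set x | forall i, a 0 i <= x 0 i <= b 0 i].

Definition lebesgue_null (R : realType) (n : nat) (N : set 'rV[R]_n) : Prop :=
  forall e : R, 0 < e ->
    exists a b : nat -> 'rV[R]_n,
      [/\ forall k i, a k 0 i <= b k 0 i,
          N `<=` \bigcup_k box (a k) (b k) &
          (\sum_(0 <= k <oo) (\prod_(i < n) (b k 0 i - a k 0 i))%:E <= e%:E)%E].

Definition ae_on (R : realType) (n : nat) (K P : set 'rV[R]_n) : Prop :=
  lebesgue_null (K `\` P).

Definition evec (R : realType) (n : nat) (i : 'I_n) : 'rV[R]_n :=
  delta_mx 0 i.

Definition partial (R : realType) (n : nat) (i : 'I_n) (g : 'rV[R]_n -> R) :
    'rV[R]_n -> R :=
  fun x => 'D_(evec R i) g x.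

Definition has_partial (R : realType) (n : nat) (i : 'I_n)
    (g : 'rV[R]_n -> R) (x : 'rV[R]_n) : Prop :=
  derivable g x (evec R i).

(** Cones and symmetric functions on them *)

Definition positive_cone (R : realType) (n : nat) : set 'rV[R]_n :=
  [set l | forall i, 0 < l 0 i].

Definition symmetric_set (R : realType) (n : nat) (G : set 'rV[R]_n) : Prop :=
  forall (s : 'S_n) l, G l -> G (col_perm s l).

Definition is_cone (R : realType) (n : nat) (G : set 'rV[R]_n) : Prop :=
  forall (t : R) l, 0 < t -> G l -> G (t *: l).

(* A function f : G -> R is represented by a total function of which only the
   values on G matter. *)
Definition symmetric_on (R : realType) (n : nat) (G : set 'rV[R]_n)
    (f : 'rV[R]_n -> R) : Prop :=
  forall (s : 'S_n) l, G l -> f (col_perm s l) = f l.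

Definition locally_lipschitz (R : realType) (n : nat) (G : set 'rV[R]_n)
    (f : 'rV[R]_n -> R) : Prop :=
  forall K, compact K -> K `<=` G -> [lipschitz f l | l in K].

(* The a.e. existence of the partial derivatives, which Rademacher's theorem
   gives for a locally Lipschitz f, is part of the assertion. *)
Definition locally_elliptic (R : realType) (n : nat) (G : set 'rV[R]_n)
    (f : 'rV[R]_n -> R) : Prop :=
  forall K, compact K -> K `<=` G ->
    exists2 cK : R, 0 < cK &
      forall i, ae_on K [set l | has_partial i f l /\ cK <= partial i f l].

Definition homogeneous1 (R : realType) (n : nat) (G : set 'rV[R]_n)
    (f : 'rV[R]_n -> R) : Prop :=
  forall (t : R) l, 0 < t -> G l -> f (t *: l) = t * f l.

(* (t, -1, ..., -1) *)
Definition tvec (R : realType) (n : nat) (t : R) : 'rV[R]_n.+1 :=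
  \row_i (if i == ord0 then t else -1).

(* The infimum of the empty set in \bar R is +oo. *)
Definition mu_minus (R : realType) (n : nat) (G : set 'rV[R]_n.+1) : \bar R :=
  ereal_inf [set t%:E | t in [set t : R | closure G (tvec n t)]].

(** C^2 functions up to the boundary of the half-space *)

Definition half_space (R : realType) (n : nat) : set 'rV[R]_n.+1 :=
  [set x | 0 < x 0 ord_max].
Arguments half_space : clear implicits.

(* The boundary value at x of a function g given in the open set U; at a point
   of U where g is continuous this is g x. *)
Definition bval (R : realType) (n : nat) (U : set 'rV[R]_n)
    (g : 'rV[R]_n -> R) (x : 'rV[R]_n) : R :=
  lim (g y @[y --> within U (nbhs x)]).

Definition extends_continuously (R : realType) (n : nat) (U : set 'rV[R]_n)
    (g : 'rV[R]_n -> R) : Prop :=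
  exists2 g' : 'rV[R]_n -> R,
    {within closure U, continuous g'} & forall x, U x -> g' x = g x.

(* v is C^2 in the open set U, and v and its partial derivatives of order at
   most 2 extend continuously to the closure of U. *)
Definition C2_closure (R : realType) (n : nat) (U : set 'rV[R]_n)
    (v : 'rV[R]_n -> R) : Prop :=
  [/\ {within closure U, continuous v},
      forall i, (forall x, U x -> has_partial i v x) /\
                extends_continuously U (partial i v) &
      forall i j, (forall x, U x -> has_partial j (partial i v) x) /\
                  extends_continuously U (partial j (partial i v))].

Definition gradient (R : realType) (n : nat) (U : set 'rV[R]_n)
    (v : 'rV[R]_n -> R) (x : 'rV[R]_n) : 'rV[R]_n :=
  \row_i bval U (partial i v) x.

Definition hessian (R : realType) (n : nat) (U : set 'rV[R]_n)
    (v : 'rV[R]_n -> R) (x : 'rV[R]_n) : 'M[R]_n :=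
  \matrix_(i, j) bval U (partial j (partial i v)) x.

(* |grad v|^2 is the Euclidean square norm. *)
Definition conf_hessian (R : realType) (n : nat) (U : set 'rV[R]_n)
    (v : 'rV[R]_n -> R) (x : 'rV[R]_n) : 'M[R]_n :=
  let dv := gradient U v x in
  expR (- 2 * v x) *:
    (- hessian U v x + dv^T *m dv - (2^-1 * \sum_i dv 0 i ^+ 2)%:M).

(* l lists the eigenvalues of M with multiplicity, in some order. *)
Definition eigenvalues_of (R : realType) (n : nat) (M : 'M[R]_n)
    (l : 'rV[R]_n) : Prop :=
  char_poly M = \prod_(i < n) ('X - (l 0 i)%:P).

Definition depends_only_on_last (R : realType) (n : nat)
    (v : 'rV[R]_n.+1 -> R) : Prop :=
  forall x y, closure (half_space R n) x -> closure (half_space R n) y ->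
    x 0 ord_max = y 0 ord_max -> v x = v y.

(* f and G being symmetric, the order of the eigenvalues is immaterial. *)
Definition solves_problem (R : realType) (n : nat) (G : set 'rV[R]_n.+1)
    (f : 'rV[R]_n.+1 -> R) (p c : R) (v : 'rV[R]_n.+1 -> R) : Prop :=
  let H := half_space R n in
  (forall x, closure H x ->
     exists l, [/\ eigenvalues_of (conf_hessian H v x) l, G l &
                   f l = expR (- p * v x)]) /\
  (forall x, frontier H x -> bval H (partial ord_max v) x = c * expR (v x)).

(* Main.v *)
(** Write [t] for the last variable, [w = v'] and [a = v''].  Up to order the
    eigenvalues of [A[v]] are [e^(-2v) (w^2/2) (s, -1, ..., -1)] with
    [s = 1 - 2a/w^2] where [w <> 0].  As [(1, -1, ..., -1)] is not in the closure
    of [G], [s] exceeds [1] by a fixed amount, so [w] solves the Riccati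
    inequality [w' <= - k w^2]; it therefore stays positive on the whole
    half-line.  The equation reads [f (s, -1, ..., -1) = 2/z] with
    [z = w^2 e^((p-2)v)], and [z' = w z (p - 1 - s) <= 0] because
    [s > mu >= p - 1].  So [f (s, -1, ..., -1)] is bounded below, which keeps [s]
    away from [mu] since [f = 1] does not accumulate on the frontier of [G],
    while homogeneity gives [f (s, -1, ..., -1) <= C s], that is [s z >= 2/C].
    Then [z + const * v] is nonincreasing, [v] is bounded, [a] is bounded above
    by a negative constant, and [w] becomes negative: a contradiction. *)

Require Import Defs.
From HB Require Import structures.
From mathcomp Require Import all_boot all_order all_algebra all_fingroup.
From mathcomp Require Import all_classical all_reals all_analysis.
From mathcomp Require Import ring lra.

Set Implicit Arguments.
Unset Strict Implicit.
Unset Printing Implicit Defensive.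

Import Order.TTheory GRing.Theory Num.Theory.
Import numFieldNormedType.Exports.

Local Open Scope classical_set_scope.
Local Open Scope ring_scope.

(** * Scalar differential inequalities on a half-line *)

Lemma is_derive_mean_value (R : realType) (u du : R -> R) (a : R) :
  (forall t, a <= t -> is_derive t 1 u (du t)) ->
  forall s t, a <= s -> s <= t ->
    exists2 c, s <= c <= t & u t - u s = du c * (t - s).
Proof.
move=> Du s t as_ st.
have Dx x : x \in `[s, t] -> is_derive x 1 u (du x).
  by rewrite in_itv /= => /andP[sx _]; apply: Du; exact: le_trans as_ sx.
have uc : {within `[s, t], continuous u}.
  by apply: derivable_within_continuous => x xst; have [] := Dx x xst.
have Dx' x : x \in `]s, t[ -> is_derive x 1 u (du x).
  by move=> xst; apply: Dx; exact: subset_itv_oo_cc.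
have [c] := MVT_segment st Dx' uc.
by rewrite in_itv /=; exists c.
Qed.

Lemma le_affine_of_derive_le (R : realType) (u du : R -> R) (a k : R) :
  (forall t, a <= t -> is_derive t 1 u (du t)) ->
  (forall t, a <= t -> du t <= k) ->
  forall t, a <= t -> u t <= u a + k * (t - a).
Proof.
move=> Du duk t at_; have [c /andP[ac _] uta] := is_derive_mean_value Du (lexx a) at_.
by rewrite -lerBlDl uta ler_wpM2r ?subr_ge0 ?duk.
Qed.

(** If [w] were nonpositive at some time, [a < 0] would make it strictly negative later, and
    [w' <= - k w^2] would then drive it to minus infinity in finite time, against differentiability
    on the whole half-line. *)
Lemma riccati_gt0 (R : realType) (w a : R -> R) (t1 k : R) (k_gt0 : 0 < k)
    (Dw : forall t, t1 <= t -> is_derive t 1 w (a t))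
    (a_lt0 : forall t, t1 <= t -> a t < 0)
    (a_le : forall t, t1 <= t -> a t <= - k * w t ^+ 2) :
  forall t, t1 <= t -> 0 < w t.
Proof.
move=> t0 t10; rewrite ltNge; apply/negP => w0.
pose t2 := t0 + 1.
have w_lt0 t : t2 <= t -> w t < 0.
  rewrite /t2 => tt; have t0t : t0 <= t by lra.
  have [c /andP[c0 _] wE] := is_derive_mean_value Dw t10 t0t.
  have : a c * (t - t0) < 0 by rewrite nmulr_rlt0 ?a_lt0 ?(le_trans t10) //; lra.
  by lra.
have t12 : t1 <= t2 by rewrite /t2; lra.
(* [1 / w] has slope at least [k], so it cannot stay negative. *)
pose u t := - (w t)^-1.
have Du t : t2 <= t -> is_derive t 1 u (w t ^- 2 * a t).
  move=> t2t; have wt : w t != 0 by rewrite lt_eqF ?w_lt0.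
  have Dwt := Dw t (le_trans t12 t2t).
  have DV := is_deriveV wt Dwt.
  by apply: is_derive_eq (is_deriveN DV) _; rewrite scaleNr opprK.
have du t : t2 <= t -> w t ^- 2 * a t <= - k.
  move=> t2t; have wt : 0 < w t ^+ 2 by rewrite exprn_even_gt0 //= lt_eqF ?w_lt0.
  by rewrite mulrC ler_pdivrMr // a_le ?(le_trans t12).
have ut2 : 0 < u t2 by rewrite oppr_gt0 invr_lt0 w_lt0.
(* The time at which the affine upper bound [u t2 - k (t - t2)] of the positive function [u]
   vanishes. *)
pose t3 := t2 + u t2 / k.
have t23 : t2 <= t3 by rewrite /t3 lerDl divr_ge0 // ltW.
have := le_affine_of_derive_le Du du t23.
have -> : u t2 + - k * (t3 - t2) = 0 by rewrite /t3; field; rewrite gt_eqF.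
by apply/negP; rewrite -ltNge oppr_gt0 invr_lt0 w_lt0.
Qed.

(* In the notation of the proof, [f (s, -1, ..., -1) = 2 / z], and [z] satisfies
   [z' = w z (p - 1 - s)]. *)
Lemma no_half_line_solution (R : realType) (v w a : R -> R) (t1 p k C : R)
    (s := fun t => 1 - 2 * a t / w t ^+ 2)
    (z := fun t => w t ^+ 2 * expR ((p - 2) * v t))
    (Dv : forall t, t1 <= t -> is_derive t 1 v (w t))
    (Dw : forall t, t1 <= t -> is_derive t 1 w (a t))
    (k_gt0 : 0 < k) (C_gt0 : 0 < C)
    (a_lt0 : forall t, t1 <= t -> a t < 0)
    (a_le : forall t, t1 <= t -> a t <= - k * w t ^+ 2)
    (s_gt : forall t, t1 <= t -> w t != 0 -> p - 1 < s t)
    (s_bound : forall e, 0 < e -> exists s0, [/\ 1 < s0, p - 1 < s0 &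
       forall t, t1 <= t -> w t != 0 -> e <= 2 / z t -> s0 <= s t])
    (growth : forall t, t1 <= t -> w t != 0 -> 2 / z t <= C * s t) :
  False.
Proof.
have w_gt0 := riccati_gt0 k_gt0 Dw a_lt0 a_le.
have w_neq0 t : t1 <= t -> w t != 0 by move=> /w_gt0 /lt0r_neq0.
have z_gt0 t : t1 <= t -> 0 < z t.
  by move=> t1t; rewrite mulr_gt0 ?expR_gt0 // exprn_gt0 ?w_gt0.
have aE t : t1 <= t -> a t = (1 - s t) / 2 * w t ^+ 2.
  by move=> t1t; rewrite /s; field; exact: w_neq0.
have Dz t : t1 <= t -> is_derive t 1 z (w t * z t * (p - 1 - s t)).
  move=> t1t; have Dvt := Dv t t1t; have Dwt := Dw t t1t.
  have De : is_derive t 1 (fun t => expR ((p - 2) * v t))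
      (expR ((p - 2) * v t) * ((p - 2) * w t)).
    exact: (@is_derive1_comp _ expR (fun t => (p - 2) * v t)).
  have Dw2 : is_derive t 1 (fun t => w t ^+ 2) (2 * w t * a t).
    apply: is_derive_eq (is_deriveX 2 Dwt) _.
    by rewrite /GRing.scale /= expr1 mulr_natl.
  apply: is_derive_eq (is_deriveM Dw2 De) _.
  by rewrite /GRing.scale /= /z aE //; field.
have z_le t : t1 <= t -> z t <= z t1.
  move=> t1t; have := le_affine_of_derive_le (k := 0) Dz _ t1t.
  rewrite mul0r addr0; apply => x t1x; have wx := w_gt0 _ t1x.
  have := s_gt x t1x (w_neq0 _ t1x); rewrite -subr_lt0 => /ltW ?.
  by apply: mulr_ge0_le0 => //; rewrite mulr_ge0 ?ltW ?z_gt0.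
have [s0 [s0_gt1 s0_gtp s0_le]] : exists s0, [/\ 1 < s0, p - 1 < s0 &
    forall t, t1 <= t -> s0 <= s t].
  have [|s0 [? ? s0P]] := s_bound (2 / z t1); first by rewrite divr_gt0 ?z_gt0.
  exists s0; split=> // t t1t; apply: s0P => //; first exact: w_neq0.
  by rewrite ler_pM2l // lef_pV2 ?posrE ?z_gt0 ?z_le.
have sz_ge t : t1 <= t -> 2 / C <= s t * z t.
  move=> t1t; have := growth t t1t (w_neq0 _ t1t).
  by rewrite ler_pdivrMr ?z_gt0 // ler_pdivrMr //; lra.
(* [s] dominates [s - q] up to a factor, for [q = p - 1] and for [q = 1]. *)
have dominate q : q < s0 -> exists2 th, 0 < th &
    forall t, t1 <= t -> th * s t <= s t - q.
  move=> qs0; have [q0|q0] := leP q 0.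
    by exists 1 => // t t1t; lra.
  have s00 : 0 < s0 by lra.
  (* For [q > 0] the ratio [(s - q) / s] increases with [s], so its value at [s0] serves as the
     factor. *)
  exists ((s0 - q) / s0) => [|t t1t]; first by rewrite divr_gt0 ?subr_gt0.
  have := s0_le t t1t; rewrite mulrAC ler_pdivrMr // => ?.
  have : 0 <= q * (s t - s0) by apply: mulr_ge0; lra.
  lra.
have v_ge t : t1 <= t -> v t1 <= v t.
  move=> t1t; have DN x : t1 <= x -> is_derive x 1 (- v) (- w x).
    by move=> t1x; have Dvx := Dv x t1x; exact: is_deriveN.
  have := le_affine_of_derive_le (k := 0) DN _ t1t.
  rewrite mul0r addr0 lerN2; apply => x t1x; have := w_gt0 _ t1x; lra.
have [V v_le] : exists V, forall t, t1 <= t -> v t <= V.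
  have [th th0 thP] := dominate _ s0_gtp.
  (* With this [d], [z' <= - th w (s z) <= - d w = - d v'], so [z + d v] is nonincreasing;
     positivity of [z] then bounds [v] from above. *)
  pose d := th * (2 / C).
  have d0 : 0 < d by rewrite mulr_gt0 // divr_gt0.
  pose y t := z t + d * v t.
  have Dy t : t1 <= t -> is_derive t 1 y (w t * z t * (p - 1 - s t) + d * w t).
    move=> t1t; have Dvt := Dv t t1t; have Dzt := Dz t t1t.
    exact: (@is_deriveD _ _ _ z (fun t => d * v t)).
  exists (y t1 / d) => t t1t; rewrite ler_pdivlMr //.
  have := le_affine_of_derive_le (k := 0) Dy _ t1t.
  rewrite mul0r addr0 => Hy; have {Hy} : y t <= y t1.
    apply: Hy => x t1x; have wx := w_gt0 _ t1x; have zx := z_gt0 _ t1x.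
    have -> : w x * z x * (p - 1 - s x) + d * w x =
      - (w x * (z x * (s x - (p - 1) - th * s x) + th * (s x * z x - 2 / C))).
      by rewrite /d; ring.
    rewrite oppr_le0; apply: mulr_ge0; first exact: ltW.
    apply: addr_ge0; apply: mulr_ge0; rewrite ?subr_ge0 ?thP ?sz_ge //; exact: ltW.
  have := z_gt0 _ t1t; rewrite {1}/y; lra.
(* The sign of [2 - p] decides which bound on [v] is used: the initial value when [p <= 2], the
   upper bound [V] otherwise. *)
have [b b0 b_le] : exists2 b, 0 < b &
    forall t, t1 <= t -> b <= expR ((2 - p) * v t).
  have [p2|p2] := leP p 2.
    exists (expR ((2 - p) * v t1)) => [|t t1t]; first exact: expR_gt0.
    by rewrite ler_expR ler_wpM2l ?v_ge ?subr_ge0.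
  exists (expR ((2 - p) * V)) => [|t t1t]; first exact: expR_gt0.
  by rewrite ler_expR ler_wnM2l ?v_le //; lra.
have [th th0 thP] := dominate _ s0_gt1.
pose d := th * b / C.
have d0 : 0 < d by rewrite divr_gt0 ?mulr_gt0.
(* [- a] is half the product of [(s - 1) z] and [expR ((2 - p) * v)]; these factors are at least
   [th * (2 / C)] and [b], which explains the value of [d]. *)
have a_led t : t1 <= t -> a t <= - d.
  move=> t1t.
  have -> : a t = - (2^-1 * ((s t - 1) * z t) * expR ((2 - p) * v t)).
    rewrite aE // /z; have -> : (2 - p) * v t = - ((p - 2) * v t) by ring.
    by rewrite expRN; field; rewrite gt_eqF ?expR_gt0.
  rewrite lerN2; have -> : d = 2^-1 * (th * (2 / C)) * b.
    by rewrite /d; field; rewrite gt_eqF.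
  apply: ler_pM; rewrite ?b_le ?(ltW b0) //.
    by rewrite !mulr_ge0 ?invr_ge0 // ?ltW.
  rewrite ler_pM2l ?invr_gt0 //; apply: (@le_trans _ _ (th * (s t * z t))).
    by rewrite ler_wpM2l ?sz_ge ?(ltW th0).
  by rewrite mulrA ler_wpM2r ?thP // ltW ?z_gt0.
(* The affine bound [w t1 - d (t - t1)] on [w] vanishes here, against [w > 0]. *)
pose t2 := t1 + w t1 / d.
have t12 : t1 <= t2 by rewrite lerDl divr_ge0 // ltW ?w_gt0.
have := le_affine_of_derive_le Dw a_led t12.
have -> : w t1 + - d * (t2 - t1) = 0 by rewrite /t2; field; rewrite gt_eqF.
by apply/negP; rewrite -ltNge w_gt0.
Qed.

(** * The curve of vectors [tvec n t], and the geometry of the cone and of the level set *)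

Lemma continuous_tvec (R : realType) n : continuous (@tvec R n).
Proof.
have -> : @tvec R n = fun t => t *: evec R ord0 + tvec n 0.
  apply/funext => t; apply/rowP => i; rewrite !mxE eqxx /=.
  by case: eqP => _; rewrite ?mulr1 ?addr0 ?mulr0 ?add0r.
move=> t; apply: cvgD; last exact: cvg_cst.
exact: cvgZr_tmp.
Qed.

Lemma tvec_norm_le (R : realType) n (t : R) : 1 <= t -> `|tvec n t| <= t.
Proof.
move=> t1; rewrite /Num.norm /= mx_normrE; apply: bigmax_le => [|i _].
  exact: le_trans ler01 t1.
rewrite mxE; case: ifP => _; last by rewrite normrN1.
by rewrite ger0_norm // (le_trans ler01).
Qed.

Section Cone.
Context (R : realType).

Lemma open_along (n : nat) (G : set 'rV[R]_n) (l d : 'rV[R]_n) :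
  open G -> G l -> exists2 e, 0 < e & G (l - e *: d).
Proof.
move=> Gop Gl.
have /(_ G) : (fun e : R => l - e *: d) @ (0:R)^'+ --> l - 0 *: d.
  apply: cvg_within_filter; apply: cvgB; first exact: cvg_cst.
  exact: cvgZr_tmp.
rewrite scale0r subr0 => /(_ (open_nbhs_nbhs (conj Gop Gl))) Ge.
have /filter_ex[e [? ?]] : \forall e \near (0:R)^'+, 0 < e /\ G (l - e *: d).
  near=> e; split; near: e; [exact: nbhs_right_gt|exact: Ge].
by exists e.
Unshelve. all: by end_near. Qed.

(** [G_add] admits only strictly positive increments; by openness [l] can first be lowered slightly,
    which turns nonnegative increments into positive ones. *)
Lemma cone_mono (n : nat) (G : set 'rV[R]_n) (G_open : open G)
    (G_add : forall l m, G l -> positive_cone m -> G (l + m)) (l l' : 'rV[R]_n) :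
  G l -> (forall i, l 0 i <= l' 0 i) -> G l'.
Proof.
move=> Gl ll'; have [e e0 Ge] := open_along (const_mx 1) G_open Gl.
have -> : l' = (l - e *: const_mx 1) + (l' - l + e *: const_mx 1).
  by apply/rowP => i; rewrite !mxE; ring.
apply: G_add => // i; rewrite !mxE mulr1 ltr_wpDl // subr_ge0; exact: ll'.
Qed.

Context (n : nat) (G : set 'rV[R]_n.+1) (f : 'rV[R]_n.+1 -> R).

(** A whole neighbourhood of [1] is sent by [tvec] outside the closure of [G]. Monotonicity of [G]
    in the first entry then excludes everything below [1 + d] as well. *)
Lemma tvec_gt1 (G_open : open G)
    (G_add : forall l m, G l -> positive_cone m -> G (l + m)) :
  ~ closure G (tvec n 1) ->
  exists2 d, 0 < d & forall s, G (tvec n s) -> 1 + d < s.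
Proof.
move=> G1.
have : nbhs (1 : R) (@tvec R n @^-1` ~` closure G).
  have G1c : nbhs (tvec n 1) (~` closure G).
    apply: open_nbhs_nbhs; split; last exact: G1.
    by apply: closed_openC; exact: closed_closure.
  exact: (@continuous_tvec R n 1 _ G1c).
move=> /nbhs_ballP[e /= e0 eP]; have e20 : 0 < e / 2 by lra.
exists (e / 2) => // s Gs; rewrite ltNge; apply/negP => se.
suff /eP : ball (1 : R) e (1 + e / 2).
  apply; apply: subset_closure; apply: cone_mono Gs _ => // i.
  by rewrite !mxE; case: eqP.
by rewrite /ball /= distrC addrAC subrr add0r gtr0_norm //; lra.
Qed.

(** By openness [s - e] is still admissible for some [e > 0]; this gives a strict inequality even in
    the extreme case [p = mu_minus G + 1]. *)
Lemma tvec_gt_mu (G_open : open G) (p s : R) :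
  (p%:E <= mu_minus G + 1)%E -> G (tvec n s) -> p - 1 < s.
Proof.
move=> pmu Gs; have [e e0 Ge] := open_along (evec R ord0) G_open Gs.
have {}Ge : G (tvec n (s - e)).
  suff -> : tvec n (s - e) = tvec n s - e *: evec R ord0 by [].
  by apply/rowP => i; rewrite !mxE eqxx; case: eqP => /=; rewrite ?mulr1 ?mulr0 ?subr0.
have : (mu_minus G <= (s - e)%:E)%E.
  by apply: ereal_inf_lbound; exists (s - e) => //; exact: subset_closure.
move=> /(leeD2r 1%E) /(le_trans pmu); rewrite -EFinD lee_fin; lra.
Qed.

(** Such a vector would put [0] in [G] by monotonicity, then a small negative multiple of
    [(1, ..., 1)] by openness, then [(-1, ..., -1)] by scaling, and finally [tvec n 1]. *)
Lemma cone_not_nonpos (G_open : open G) (G_cone : is_cone G)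
    (G_add : forall l m, G l -> positive_cone m -> G (l + m))
    (G_star : ~ closure G (tvec n 1)) (l : 'rV[R]_n.+1) :
  (forall i, l 0 i <= 0) -> ~ G l.
Proof.
move=> l0 Gl; have G0 : G 0 by apply: cone_mono Gl _ => // i; rewrite mxE.
have [e e0] := open_along (const_mx 1) G_open G0.
have e1 : 0 < e^-1 by rewrite invr_gt0.
move=> /(G_cone _ _ e1); apply: contra_not G_star => Ge; apply: subset_closure.
apply: cone_mono Ge _ => // i; rewrite !mxE mulr1 sub0r mulrN mulVf ?(gt_eqF e0) //.
by case: ifP => // _; lra.
Qed.

Lemma level_sub (G_open : open G) :
  closure [set l | G l /\ f l = 1] `&` frontier G = set0 ->
  closure [set l | G l /\ f l = 1] `<=` G.
Proof.
move=> F0 x Fx; apply: contrapT => NGx.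
suff : (closure [set l | G l /\ f l = 1] `&` frontier G) x by rewrite F0.
split=> //; split=> [|/interior_subset //].
by apply: closure_subset Fx => y [].
Qed.

Lemma level_scale (G_cone : is_cone G) (f_hom : homogeneous1 G f) (l : 'rV[R]_n.+1) :
  G l -> 0 < f l -> closure [set l | G l /\ f l = 1] ((f l)^-1 *: l).
Proof.
move=> Gl fl; have fl1 : 0 < (f l)^-1 by rewrite invr_gt0.
apply: subset_closure; split; first exact: G_cone.
by rewrite f_hom // mulVf // gt_eqF.
Qed.

(* The level set [f = 1] stays away from the origin. *)
Lemma homogeneous_growth (G_cone : is_cone G) (f_hom : homogeneous1 G f) :
  ~ closure [set l | G l /\ f l = 1] 0 ->
  exists2 C, 0 < C & forall l, G l -> 0 < f l -> f l <= C * `|l|.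
Proof.
set F := closure _ => F0.
have : \forall x \near (0 : 'rV[R]_n.+1), (~` F) x.
  by apply: open_nbhs_nbhs; split => //; apply: closed_openC; exact: closed_closure.
move=> /nbhs_ballP[e /= e0 eF].
exists e^-1 => [|l Gl fl]; first by rewrite invr_gt0.
rewrite mulrC ler_pdivlMr // leNgt; apply/negP => le.
(* The point [l / f l] lies on the level set, and [|l| < e f l] would place it in the ball that
   avoids this set. *)
have /eF : ball (0 : 'rV[R]_n.+1) e ((f l)^-1 *: l).
  rewrite -ball_normE /= sub0r normrN normrZ gtr0_norm ?invr_gt0 //.
  by rewrite mulrC ltr_pdivrMr // mulrC.
by apply; exact: level_scale.
Qed.

(* By compactness, [f (s, -1, ..., -1) >= e] keeps [s] away from any lower bound
   [m] of [{s | (s, -1, ..., -1) in G}], since the level set [f = 1] does not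
   accumulate on the boundary of [G]. *)
Lemma tvec_level_gap (G_cone : is_cone G) (f_hom : homogeneous1 G f)
    (m e : R) :
  closure [set l | G l /\ f l = 1] `<=` G -> ~ G 0 ->
  (forall s, G (tvec n s) -> m < s) -> 0 < e ->
  exists2 s0, m < s0 & forall s, G (tvec n s) -> e <= f (tvec n s) -> s0 <= s.
Proof.
set F := closure _ => FG G0 mG e0.
pose h (x : R * R) := x.1 *: tvec n x.2.
have hc : continuous h.
  move=> x; apply: cvgZ; first exact: cvg_fst.
  by apply: (@cvg_comp _ _ _ snd (@tvec R n)); [exact: cvg_snd|exact: continuous_tvec].
(* If [f (tvec n s) >= e], then [r = 1 / f (tvec n s)] lies in [[0, 1/e]] and [r *: tvec n s] is on
   the level set. The window [[m, m + 1]] for [s] makes [K] compact, so its projection to [s] is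
   closed. *)
pose K : set (R * R) := (`[0, e^-1] `*` `[m, m + 1]) `&` (h @^-1` F).
have cK : compact K.
  apply: compact_closedI; first by apply: compact_setX; exact: segment_compact.
  by apply: closed_comp => [x _|]; [exact: hc|exact: closed_closure].
have cK2 : closed (snd @` K).
  apply: compact_closed; first exact: Rhausdorff.
  apply: continuous_compact => //; apply: continuous_subspaceT => x; exact: cvg_snd.
(* As [F] lies in [G], a pair [(r, m)] in [K] would put [0] in [G] if [r = 0], and [tvec n m] in [G]
   if [r > 0], against [mG]. *)
have Nm : ~ (snd @` K) m.
  move=> [[r s] [[/=]]]; rewrite !in_itv /= => /andP[r0 _] _ /FG Grs sm.
  move: Grs; rewrite /h sm /= => Grm.
  have [rE|r_neq0] := eqVneq r 0; first by move: Grm; rewrite rE scale0r.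
  have ri : 0 < r^-1 by rewrite invr_gt0 lt_def r_neq0.
  move: Grm => /(G_cone _ _ ri); rewrite scalerA mulVf // scale1r => /mG.
  by rewrite ltxx.
have : \forall s \near m, (~` (snd @` K)) s.
  by apply: open_nbhs_nbhs; split => //; exact: closed_openC.
move=> /nbhs_ballP[d /= d0 dK].
exists (m + Num.min d 1) => [|s Gs fs]; first by rewrite ltrDl lt_min d0 ltr01.
rewrite leNgt; apply/negP => sd; have ms := mG _ Gs.
have [sd1 sd2] : s - m < d /\ s - m < 1.
  by apply/andP; rewrite -lt_min; move: sd; lra.
have /dK : ball m d s by rewrite /ball /= distrC gtr0_norm //; lra.
have f0 : 0 < f (tvec n s) by exact: lt_le_trans fs.
apply; exists ((f (tvec n s))^-1, s) => //; split; last exact: level_scale.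
split; rewrite /= in_itv /=; last by apply/andP; split; lra.
by rewrite invr_ge0 (ltW f0) lef_pV2.
Qed.

End Cone.

(** * Functions of the last variable: derivatives, boundary values and the spectrum of [A[v]] *)

Lemma diag_eigenvalues_perm (R : realType) n (A : 'M[R]_n) (l : 'rV[R]_n) :
  is_diag_mx A -> eigenvalues_of A l ->
  exists s : 'S_n, (\row_i A i i) = col_perm s l.
Proof.
move=> Ad; rewrite /eigenvalues_of char_poly_trig ?is_diag_mx_is_trig // => El.
pose t1 := [tuple A i i | i < n]; pose t2 := [tuple l 0 i | i < n].
(* Both lists are the roots, with multiplicity, of the same characteristic polynomial. *)
have : perm_eq t1 t2.
  apply: prod_XsubC_eq; rewrite !big_tuple.
  under eq_bigr do rewrite tnth_mktuple.
  by rewrite El; apply: eq_bigr => i _; rewrite tnth_mktuple.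
move=> /tuple_permP[s st]; exists s; apply/rowP => i; rewrite !mxE.
have : tnth t1 i = tnth [tuple tnth t2 (s i) | i < n] i.
  by congr tnth; exact: val_inj.
by rewrite !tnth_mktuple.
Qed.

Section Reduction.
Context (R : realType) (n : nat).
Local Notation H := (half_space R n).
Local Notation en := (evec R (@ord_max n)).

(** Stated on the open half-space, unlike [depends_only_on_last], so that the property is inherited
    by partial derivatives. *)
Definition last_dependent (u : 'rV[R]_n.+1 -> R) :=
  forall x y, H x -> H y -> x 0 ord_max = y 0 ord_max -> u x = u y.

Lemma open_half_space : open H.
Proof.
apply: (@open_comp _ _ (fun x : 'rV[R]_n.+1 => x 0 ord_max) [set r | 0 < r]).
  by move=> x _; exact: (@coord_continuous R 1 n.+1 0 ord_max).
exact: open_gt.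
Qed.

Lemma half_space_nbhs x : H x -> \forall y \near x, H y.
Proof. by move=> Hx; apply: open_nbhs_nbhs; split => //; exact: open_half_space. Qed.

Lemma half_space_line (t : R) : 0 < t -> H (t *: en).
Proof. by move=> t0; rewrite /half_space /= !mxE !eqxx mulr1. Qed.

(** Translation by [y - x] keeps the last coordinate, so [u] coincides near [x] with its translate,
    whose derivative at [x] is that of [u] at [y]. *)
Lemma last_dependent_partial u i :
  last_dependent u -> last_dependent (partial i u).
Proof.
move=> uP x y Hx Hy xy.
have -> : partial i u x = partial i (u \o shift (y - x)) x.
  apply: near_eq_derive; near=> z.
  have Hz : H z by near: z; exact: half_space_nbhs.
  have zE : (z + (y - x)) 0 ord_max = z 0 ord_max.
    by rewrite !mxE xy subrr addr0.
  by apply: uP => //; rewrite /half_space /= zE.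
have E : (u \o shift (y - x)) \o shift x = u \o shift y.
  by apply/funext => z /=; rewrite -addrA subrKC.
by rewrite /partial /derive E /= subrKC.
Unshelve. all: by end_near. Qed.

Lemma partial_eq0 u i x :
  (forall y, H y -> u y = 0) -> H x -> partial i u x = 0.
Proof.
move=> u0 Hx; rewrite /partial (@near_eq_derive _ _ _ u (cst 0)) ?derive_cst //.
near=> y; apply: u0; near: y; exact: half_space_nbhs.
Unshelve. all: by end_near. Qed.

Lemma partial_last_dependent_eq0 u i x :
  last_dependent u -> i != ord_max -> H x -> partial i u x = 0.
Proof.
move=> uP ilast Hx; rewrite /partial /derive.
apply: lim_near_cst; first exact: Rhausdorff.
near=> h; rewrite /= (uP _ x) ?subrr ?scaler0 // /half_space /= !mxE.
  by rewrite eqxx eq_sym (negbTE ilast) mulr0 add0r.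
by rewrite eqxx eq_sym (negbTE ilast) mulr0 add0r.
Unshelve. all: by end_near. Qed.

Lemma is_derive_line (u : 'rV[R]_n.+1 -> R) (t : R) :
  has_partial ord_max u (t *: en) ->
  is_derive t 1 (fun s => u (s *: en)) (partial ord_max u (t *: en)).
Proof.
have E : (fun h : R => h^-1 *: ((u \o shift (t *: en)) (h *: en) - u (t *: en))) =
  (fun h : R => h^-1 *: (((fun s => u (s *: en)) \o shift t) (h *: 1) - u (t *: en))).
  by apply/funext => h /=; rewrite -scalerDl /GRing.scale /= mulr1.
rewrite /has_partial /derivable E => D.
by apply: DeriveDef => //; rewrite /partial /derive E.
Qed.

Lemma extension_cvg (U : set 'rV[R]_n.+1) (g g' : 'rV[R]_n.+1 -> R) x :
  {within closure U, continuous g'} -> (forall y, U y -> g' y = g y) ->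
  closure U x -> g y @[y --> within U (nbhs x)] --> g' x.
Proof.
move=> /subspace_continuousP cg' gg' Ux.
have gx : g' y @[y --> within U (nbhs x)] --> g' x.
  apply: cvg_trans (cg' x Ux); apply: cvg_app; apply: within_subset.
  exact: subset_closure.
apply: cvg_trans gx; apply: near_eq_cvg.
by rewrite near_withinE; apply: nearW => y Uy; rewrite gg'.
Qed.

Lemma bval_cvg (U : set 'rV[R]_n.+1) g x :
  extends_continuously U g -> closure U x ->
  g y @[y --> within U (nbhs x)] --> bval U g x.
Proof.
move=> [g' cg' gg'] Ux; have gx := extension_cvg cg' gg' Ux.
have PF : ProperFilter (within U (nbhs x)) by exact: within_nbhs_proper.
by rewrite /bval (cvg_lim _ gx) //; exact: Rhausdorff.
Qed.

Lemma bval_in (U : set 'rV[R]_n.+1) g x :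
  extends_continuously U g -> U x -> bval U g x = g x.
Proof.
move=> [g' cg' gg'] Ux; have Ucx : closure U x by exact: subset_closure.
have PF : ProperFilter (within U (nbhs x)) by exact: within_nbhs_proper.
apply: cvg_lim; first exact: Rhausdorff.
by rewrite -(gg' x Ux); exact: extension_cvg.
Qed.

Lemma half_space_frontier0 : frontier H 0.
Proof.
split; last by move=> /interior_subset; rewrite /half_space /= mxE ltxx.
move=> B B0.
have : (fun t : R => t *: en) @ (0:R)^'+ --> 0 *: en.
  by apply: cvg_within_filter; exact: cvgZr_tmp.
rewrite scale0r => /(_ _ B0) Be.
have /filter_ex[t [? ?]] : \forall t \near (0:R)^'+, 0 < t /\ B (t *: en).
  near=> t; split; near: t; [exact: nbhs_right_gt|exact: Be].
by exists (t *: en); split => //; exact: half_space_line.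
Unshelve. all: by end_near. Qed.

(** Carries the sign given by the boundary condition to an interior point, where the derivatives are
    genuine; the boundary value is a limit from inside. *)
Lemma half_space_pos_point (g : 'rV[R]_n.+1 -> R) :
  extends_continuously H g -> 0 < bval H g 0 -> exists2 x, H x & 0 < g x.
Proof.
move=> gext g0; have [cl0 _] := half_space_frontier0.
have PF : ProperFilter (within H (nbhs (0 : 'rV[R]_n.+1))).
  exact: within_nbhs_proper.
have gpos : \forall x \near within H (nbhs (0 : 'rV[R]_n.+1)), 0 < g x.
  exact: (cvgr_gt (bval H g 0) (bval_cvg gext cl0) 0 g0).
have Hnear : \forall x \near within H (nbhs (0 : 'rV[R]_n.+1)), H x.
  exact: withinT.
by have [x [Hx gx]] := filter_ex (filterI Hnear gpos); exists x.
Qed.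

(* The simple eigenvalue, attached to the last direction, is moved to the first
   slot, the one distinguished in [tvec]. *)
Lemma conf_hessian_line (v : 'rV[R]_n.+1 -> R) (t : R)
    (w := partial ord_max v (t *: en))
    (a := partial ord_max (partial ord_max v) (t *: en))
    (e := expR (- 2 * v (t *: en))) (l : 'rV[R]_n.+1) :
  C2_closure H v -> last_dependent v -> 0 < t ->
  eigenvalues_of (conf_hessian H v (t *: en)) l ->
  exists s : 'S_n.+1, col_perm s l =
    \row_i (if i == ord0 then e * (w ^+ 2 / 2 - a) else - (e * w ^+ 2 / 2)).
Proof.
move=> [_ C1 C2] vP t0.
have Hx := half_space_line t0; set x := t *: en in w a e Hx *.
have gradE i : gradient H v x 0 i = if i == ord_max then w else 0.
  rewrite mxE bval_in //; last by have [] := C1 i.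
  by case: eqP => [->//|/eqP ?]; exact: partial_last_dependent_eq0.
have hessE i j : hessian H v x i j =
    if (i == ord_max) && (j == ord_max) then a else 0.
  rewrite mxE bval_in //; last by have [] := C2 i j.
  case: eqP => [->|/eqP im] /=.
    case: eqP => [->//|/eqP ?]; apply: partial_last_dependent_eq0 => //.
    exact: last_dependent_partial.
  by apply: partial_eq0 => // y Hy; exact: partial_last_dependent_eq0.
have sumE : \sum_i gradient H v x 0 i ^+ 2 = w ^+ 2.
  rewrite (bigD1 ord_max) //= gradE eqxx big1 ?addr0 // => i im.
  by rewrite gradE (negbTE im) expr0n.
have AE i j : conf_hessian H v x i j = if i == j then
    (if i == ord_max then e * (w ^+ 2 / 2 - a) else - (e * w ^+ 2 / 2)) else 0.
  rewrite /conf_hessian sumE mxE mxE mxE mxE hessE mxE big_ord1 mxE !gradE mxE mxE -/e.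
  have [<-|ij] := eqVneq i j; first by case: eqP => _ /=; field.
  have [im|_] := eqVneq i ord_max; last by rewrite /= mul0r oppr0; ring.
  have [jm|_] := eqVneq j ord_max; first by rewrite im jm eqxx in ij.
  by rewrite /=; ring.
have Ad : is_diag_mx (conf_hessian H v x).
  by apply/is_diag_mxP => i j ij; rewrite AE -val_eqE /= (negbTE ij).
move=> /(diag_eigenvalues_perm Ad)[s sl].
exists (tperm ord0 ord_max * s)%g; rewrite col_permM -sl.
apply/rowP => i; rewrite [LHS]mxE [LHS]mxE AE [RHS]mxE eqxx.
have -> : (tperm ord0 ord_max i == ord_max) = (i == ord0) :> bool.
  by rewrite -[X in _ == X](tpermL ord0 ord_max) (inj_eq perm_inj).
by [].
Qed.

End Reduction.

(** * From a one-variable solution to the contradiction on a half-line *)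

Theorem proposition4p1 (R : realType) (n : nat) (hn : (2 <= n.+1)%N)
    (p c : R) (hp : 0 <= p) (hc : 0 < c)
    (G : set 'rV[R]_n.+1) (f : 'rV[R]_n.+1 -> R)
    (G_proper : G <> setT) (G_nonempty : G !=set0) (G_open : open G)
    (G_symmetric : symmetric_set G) (G_cone : is_cone G)
    (G_add : forall l m, G l -> positive_cone m -> G (l + m))
    (f_symmetric : symmetric_on G f)
    (f_lipschitz : locally_lipschitz G f)
    (f_elliptic : locally_elliptic G f)
    (G_lambda_star : ~ closure G (tvec n 1))
    (G_en : ~ frontier G (evec R (@ord_max n)))
    (f_homogeneous : homogeneous1 G f)
    (f_level : closure [set l | G l /\ f l = 1] `&` frontier G = set0)
    (hp_mu : (p%:E <= mu_minus G + 1)%E) :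
  ~ exists v : 'rV[R]_n.+1 -> R,
      [/\ C2_closure (half_space R n) v,
          depends_only_on_last v &
          solves_problem G f p c v].
Proof.
move=> [v [C2v vdep [veq vbd]]].
pose H := half_space R n; pose line (t : R) := t *: evec R (@ord_max n).
have vlast : last_dependent v.
  by move=> x y Hx Hy; apply: vdep; exact: subset_closure.
pose w t := partial ord_max v (line t).
pose a t := partial ord_max (partial ord_max v) (line t).
have Hline t : 0 < t -> H (line t) by exact: half_space_line.
have [_ C1 C2] := C2v.
have nonpos := cone_not_nonpos G_open G_cone G_add G_lambda_star.
have G0 : ~ G 0 by apply: nonpos => i; rewrite mxE.
have FG := level_sub G_open f_level.
have [d d0 sd] := tvec_gt1 G_open G_add G_lambda_star.
have sp s : G (tvec n s) -> p - 1 < s by exact: tvec_gt_mu.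
have [C C0 fC] := homogeneous_growth G_cone f_homogeneous (fun F0 => G0 (FG _ F0)).
have [t1 t10 w1] : exists2 t1, 0 < t1 & 0 < w t1.
  have [_ Cw] := C1 ord_max.
  have wpos : 0 < bval H (partial ord_max v) 0.
    by rewrite (vbd 0 (half_space_frontier0 R n)) mulr_gt0 ?expR_gt0.
  have [x Hx wx] := half_space_pos_point Cw wpos.
  have x0 : 0 < x 0 ord_max := Hx.
  exists (x 0 ord_max); first exact: x0.
  have xE : x 0 ord_max = line (x 0 ord_max) 0 ord_max.
    by rewrite !mxE !eqxx mulr1.
  have := last_dependent_partial ord_max vlast Hx (Hline _ x0) xE.
  by rewrite /w => <-.
have eig t (e := expR (- 2 * v (line t))) : 0 < t ->
    let l := \row_i (if i == ord0 then e * (w t ^+ 2 / 2 - a t)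
                     else - (e * w t ^+ 2 / 2)) in
    G l /\ f l = expR (- p * v (line t)).
  move=> t0; have [l [el Gl fl]] := veq _ (subset_closure (Hline _ t0)).
  have [s <-] := conf_hessian_line C2v vlast t0 el.
  by split; [exact: G_symmetric|rewrite f_symmetric].
pose s t := 1 - 2 * a t / w t ^+ 2.
pose z t := w t ^+ 2 * expR ((p - 2) * v (line t)).
have tv t : 0 < t -> w t != 0 -> G (tvec n (s t)) /\ f (tvec n (s t)) = 2 / z t.
  move=> t0 wt; have [] := eig t t0; set e := expR _; set l := \row_i _.
  move=> Gl fl; have e0 : 0 < e by exact: expR_gt0.
  have w20 : 0 < w t ^+ 2 by rewrite exprn_even_gt0.
  (* The factor that normalizes the repeated eigenvalue to [-1]; the simple one becomes [s t]. *)
  pose k := 2 / (e * w t ^+ 2).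
  have k0 : 0 < k by rewrite divr_gt0 // mulr_gt0.
  have -> : tvec n (s t) = k *: l.
    apply/rowP => i; rewrite !mxE /s /k.
    by case: eqP => _; field; rewrite wt gt_eqF.
  split; first exact: G_cone.
  rewrite f_homogeneous // fl /k /z.
  have -> : (p - 2) * v (line t) = - 2 * v (line t) - (- p * v (line t)) by ring.
  by rewrite expRB -/e; field; rewrite wt !gt_eqF ?expR_gt0.
(* Where [w = 0] the eigenvalues are [- e a, 0, ..., 0], so [a >= 0] would put a nonpositive vector
   in [G]; elsewhere [s > 1] gives the sign. *)
have a_lt0 t : 0 < t -> a t < 0.
  move=> t0; have [w0|wt] := eqVneq (w t) 0.
    rewrite ltNge; apply/negP => at0; have [+ _] := eig t t0.
    apply: nonpos => i; rewrite mxE w0 expr0n /= mul0r mulr0 mul0r oppr0 sub0r.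
    by case: ifP => // _; rewrite mulrN oppr_le0 mulr_ge0 // ltW ?expR_gt0.
  have [/sd + _] := tv t t0 wt; rewrite /s => st.
  have : 2 * a t / w t ^+ 2 < 0 by lra.
  rewrite pmulr_llt0 ?invr_gt0 ?exprn_even_gt0 //; lra.
have a_le t : 0 < t -> a t <= - (d / 2) * w t ^+ 2.
  move=> t0; have [w0|wt] := eqVneq (w t) 0.
    by rewrite w0 expr0n /= mulr0 ltW ?a_lt0.
  have w20 : 0 < w t ^+ 2 by rewrite exprn_even_gt0.
  have [/sd + _] := tv t t0 wt; rewrite /s => st.
  rewrite -ler_pdivrMr //.
  have : 2 * a t / w t ^+ 2 <= - d by lra.
  by rewrite -mulrA; lra.
have pos t : t1 <= t -> 0 < t by exact: lt_le_trans.
have d20 : 0 < d / 2 by lra.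
have Dv t : t1 <= t -> is_derive t 1 (fun t => v (line t)) (w t).
  move=> /pos/Hline Ht; apply: is_derive_line.
  by have [+ _] := C1 ord_max; exact.
have Dw t : t1 <= t -> is_derive t 1 w (a t).
  move=> /pos/Hline Ht; apply: (@is_derive_line _ _ (partial ord_max v)).
  by have [+ _] := C2 ord_max ord_max; exact.
have s_bound e : 0 < e -> exists s0, [/\ 1 < s0, p - 1 < s0 &
    forall t, t1 <= t -> w t != 0 -> e <= 2 / z t -> s0 <= s t].
  (* Taking the larger of the two lower bounds yields a single gap [s0] above both [1] and
     [p - 1]. *)
  move=> e0; pose m := Num.max 1 (p - 1).
  have [|s0] := tvec_level_gap (m := m) G_cone f_homogeneous FG G0 _ e0.
    by move=> x Gx; rewrite gt_max sp // andbT; have := sd _ Gx; lra.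
  rewrite gt_max => /andP[s01 s0p] s0P; exists s0; split => // t /pos t0 wt.
  by have [Gs <-] := tv t t0 wt; exact: s0P.
have growth t : t1 <= t -> w t != 0 -> 2 / z t <= C * s t.
  move=> /pos t0 wt; have [Gs fs] := tv t t0 wt.
  have z0 : 0 < z t by rewrite mulr_gt0 ?expR_gt0 // exprn_even_gt0.
  rewrite -fs; apply: le_trans (fC _ Gs _) _.
    by rewrite fs divr_gt0.
  (* Since [s > 1], the sup norm of [(s, -1, ..., -1)] is at most [s]. *)
  rewrite ler_pM2l //; apply: tvec_norm_le; have := sd _ Gs; lra.
have s_gt t : t1 <= t -> w t != 0 -> p - 1 < s t.
  by move=> /pos t0 wt; have [Gs _] := tv t t0 wt; exact: sp.
exact: (no_half_line_solution Dv Dw d20 C0 (fun t h => a_lt0 t (pos t h))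
  (fun t h => a_le t (pos t h)) s_gt s_bound growth).
Qed.
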